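(* Let $C(z)=\sum_{n\ge 0}c_n z^n$, where $c_n$ is the number of nonnesting permutations of the multiset $\{1,1,2,2,\dots,n,n\}$ that avoid the pattern $123$ (with $c_0=1$). Then $C$ is algebraic of degree exactly $4$ over $\mathbb{Q}(z)$: it is the unique formal power series with $C(0)=1$ and $[z]C=1$ (coefficient of $z^1$ equal to $1$) satisfying \begin{multline*} (1-4z+4z^2)+(-4+16z-16z^2)\,C+(5-22z+36z^2+8z^3)\,C^2\\ +(-2+12z-40z^2-16z^3)\,C^3+(-2z+17z^2+12z^3+4z^4)\,C^4=0 . \end{multline*}
   Context: For $n\ge 0$, a nonnesting permutation of $\{1,1,2,2,\dots,n,n\}$ is a word $w=w_1w_2\cdots w_{2n}$ using each of the labels $1,\dots,n$ exactly twice such that there are no indices $i<j<k<\ell$ and labels $a\ne b$ with $w_i=w_\ell=a$ and $w_j=w_k=b$. The word $w$ avoids $123$ if there are no indices $i<j<k$ with $w_i<w_j<w_k$. The empty word is the unique such word for $n=0$. *)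

(* Defs.v *)
From HB Require Import structures.
From mathcomp Require Import all_boot all_order all_algebra.
From mathcomp Require Import boolp.

Set Implicit Arguments.
Unset Strict Implicit.
Unset Printing Implicit Defensive.

Import GRing.Theory.
Local Open Scope ring_scope.
Local Open Scope quotient_scope.

(* Words over the ordered alphabet 'I_n; its n labels 0 < ... < n.-1 stand for
   1 < ... < n. *)

Definition nonnesting n (w : n.*2.-tuple 'I_n) : bool :=
  [forall a : 'I_n, count_mem a w == 2%N] &&
  ~~ [exists i : 'I_(n.*2), exists j : 'I_(n.*2),
      exists k : 'I_(n.*2), exists l : 'I_(n.*2),
      [&& (i < j)%N, (j < k)%N, (k < l)%N, tnth w i == tnth w l,
          tnth w j == tnth w k & tnth w i != tnth w j]].

Definition avoids123 n (w : n.*2.-tuple 'I_n) : bool :=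
  ~~ [exists i : 'I_(n.*2), exists j : 'I_(n.*2), exists k : 'I_(n.*2),
      [&& (i < j)%N, (j < k)%N, (tnth w i < tnth w j)%N
        & (tnth w j < tnth w k)%N]].

Definition nonnesting123_count (n : nat) : nat :=
  #|[set w : n.*2.-tuple 'I_n | nonnesting w && avoids123 w]|.

(* Formal power series: a record rather than a bare [nat -> R], so that the
   Cauchy product cannot be confused with the pointwise product of functions. *)

Record fps (R : Type) := Fps { coefs : nat -> R }.

Notation "{ 'fps' R }" := (fps R) (format "{ 'fps'  R }") : type_scope.

HB.instance Definition _ (R : Type) := [isNew for (@coefs R)].
HB.instance Definition _ (R : choiceType) := [Choice of {fps R} by <:].

Lemma fpsP (R : Type) (f g : {fps R}) : coefs f =1 coefs g -> f = g.
Proof. by case: f g => [f] [g] /= /funext ->. Qed.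

Section FpsZmod.
Variable R : zmodType.
Implicit Types f g h : {fps R}.

Definition fps_zero : {fps R} := Fps (fun=> 0).
Definition fps_opp f := Fps (fun n => - coefs f n).
Definition fps_add f g := Fps (fun n => coefs f n + coefs g n).

Fact fps_addA : associative fps_add.
Proof. by move=> f g h; apply: fpsP => n /=; rewrite addrA. Qed.
Fact fps_addC : commutative fps_add.
Proof. by move=> f g; apply: fpsP => n /=; rewrite addrC. Qed.
Fact fps_add0 : left_id fps_zero fps_add.
Proof. by move=> f; apply: fpsP => n /=; rewrite add0r. Qed.
Fact fps_addN : left_inverse fps_zero fps_opp fps_add.
Proof. by move=> f; apply: fpsP => n /=; rewrite addNr. Qed.

HB.instance Definition _ := GRing.isZmodule.Build {fps R}
  fps_addA fps_addC fps_add0 fps_addN.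

End FpsZmod.

Section FpsRing.
Variable R : comNzRingType.
Implicit Types f g h : {fps R}.

Definition fps_one : {fps R} := Fps (fun n => (n == 0%N)%:R).
Definition fps_mul f g :=
  Fps (fun n => \sum_(i < n.+1) coefs f i * coefs g (n - i)).

Let trunc n f : {poly R} := \poly_(i < n) coefs f i.

Let coef_mul_trunc m n f g : (n < m)%N ->
  coefs (fps_mul f g) n = (trunc m f * trunc m g)`_n.
Proof.
move=> lt_nm; rewrite coefM; apply: eq_bigr => i _; rewrite !coef_poly.
have le_in : (i <= n)%N by rewrite -ltnS.
by rewrite !(leq_ltn_trans _ lt_nm) ?leq_subr.
Qed.

Let coef_trunc_mul m n f g : (n < m)%N ->
  (trunc m (fps_mul f g))`_n = (trunc m f * trunc m g)`_n.
Proof. by move=> lt_nm; rewrite coef_poly lt_nm (coef_mul_trunc _ _ lt_nm). Qed.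

Fact fps_mulC : commutative fps_mul.
Proof.
by move=> f g; apply: fpsP => n; rewrite !(coef_mul_trunc _ _ (ltnSn n)) mulrC.
Qed.

Fact fps_mulA : associative fps_mul.
Proof.
move=> f g h; apply: fpsP => n; rewrite !(coef_mul_trunc _ _ (ltnSn n)).
transitivity ((trunc n.+1 f * (trunc n.+1 g * trunc n.+1 h))`_n).
  rewrite !coefM; apply: eq_bigr => i _; congr (_ * _).
  by rewrite coef_trunc_mul // ltnS leq_subr.
rewrite mulrA !coefM; apply: eq_bigr => i _; congr (_ * _).
by rewrite coef_trunc_mul.
Qed.

Fact fps_mul1 : left_id fps_one fps_mul.
Proof.
move=> f; apply: fpsP => n /=; rewrite big_ord_recl /= mul1r subn0.
by rewrite big1 ?addr0 // => i _; rewrite mul0r.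
Qed.

Fact fps_mulDl : left_distributive fps_mul +%R.
Proof.
move=> f g h; apply: fpsP => n /=; rewrite -big_split /=.
by apply: eq_bigr => i _; rewrite mulrDl.
Qed.

Fact fps_one_neq0 : fps_one != 0.
Proof.
by apply/eqP => /(congr1 (fun f => coefs f 0%N))/eqP; rewrite /= oner_eq0.
Qed.

HB.instance Definition _ := GRing.Zmodule_isComNzRing.Build {fps R}
  fps_mulA fps_mulC fps_mul1 fps_mulDl fps_one_neq0.

Lemma coefs0 n : coefs (0 : {fps R}) n = 0. Proof. by []. Qed.
Lemma coefs1 n : coefs (1 : {fps R}) n = (n == 0%N)%:R. Proof. by []. Qed.
Lemma coefsD f g n : coefs (f + g) n = coefs f n + coefs g n.
Proof. by []. Qed.
Lemma coefsN f n : coefs (- f) n = - coefs f n. Proof. by []. Qed.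
Lemma coefsM f g n :
  coefs (f * g) n = \sum_(i < n.+1) coefs f i * coefs g (n - i).
Proof. by []. Qed.

(* The multiplicative inverse is determined by the ring structure, so it is
   obtained by choice rather than by the usual recursion on coefficients. *)

Definition fps_unit : pred {fps R} := fun f => `[< exists g, g * f = 1 >].
Definition fps_inv f : {fps R} :=
  if pselect (exists g, g * f = 1) is left ex then projT1 (cid ex) else f.

Fact fps_mulVf : {in fps_unit, left_inverse 1 fps_inv *%R}.
Proof.
move=> f /asboolP f_unit; rewrite /fps_inv.
by case: pselect => // ex; case: cid.
Qed.

Fact fps_unitPl f g : g * f = 1 -> fps_unit f.
Proof. by move=> gf1; apply/asboolP; exists g. Qed.

Fact fps_inv_out : {in [predC fps_unit], fps_inv =1 id}.
Proof.
move=> f; rewrite inE => /asboolPn f_nunit; rewrite /fps_inv.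
by case: pselect.
Qed.

HB.instance Definition _ := GRing.ComNzRing_hasMulInverse.Build {fps R}
  fps_mulVf fps_unitPl fps_inv_out.

End FpsRing.

Section FpsDomain.
Variable R : idomainType.
Implicit Types f g : {fps R}.

Let fps_val f : f != 0 ->
  exists2 n, coefs f n != 0 & forall i, (i < n)%N -> coefs f i = 0.
Proof.
move=> f_neq0; have ex : exists n, coefs f n != 0.
  apply: contrapT => /forallNP f0; case/eqP: f_neq0; apply: fpsP => n.
  by apply/eqP; apply: contrapT => /negP; apply: f0.
case: (ex_minnP ex) => n fn_neq0 min_n; exists n => // i lt_in.
by apply/eqP; apply: contraTT lt_in => /min_n; rewrite -leqNgt.
Qed.

Fact fps_mulf_eq0 f g : f * g = 0 -> (f == 0) || (g == 0).
Proof.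
move=> fg0; apply: contrapT => /negP; rewrite negb_or => /andP[].
case/fps_val=> m fm_neq0 f_lt /fps_val[n gn_neq0 g_lt].
have /eqP := congr1 (fun h => coefs h (m + n)) fg0.
have lt_m : (m < (m + n).+1)%N by rewrite ltnS leq_addr.
rewrite coefsM coefs0 (bigD1 (Ordinal lt_m)) //= addKn big1 => [|i i_neq].
  by rewrite addr0 mulf_eq0 (negPf fm_neq0) (negPf gn_neq0).
have [lt_im|le_mi] := ltnP i m; first by rewrite f_lt ?mul0r.
have lt_mi : (m < i)%N by rewrite ltn_neqAle le_mi andbT eq_sym.
by rewrite g_lt ?mulr0 // ltn_subLR ?ltn_add2r // -ltnS.
Qed.

HB.instance Definition _ :=
  GRing.ComUnitRing_isIntegral.Build {fps R} fps_mulf_eq0.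

End FpsDomain.

Section FpsPoly.
Variable R : idomainType.

Definition fps_of_poly (p : {poly R}) : {fps R} := Fps (fun n => p`_n).

Definition fpsX : {fps R} := fps_of_poly 'X.

Fact fps_of_poly_zmod_morphism : zmod_morphism fps_of_poly.
Proof. by move=> p q; apply: fpsP => n; rewrite /= coefB. Qed.
HB.instance Definition _ := GRing.isZmodMorphism.Build {poly R} {fps R}
  fps_of_poly fps_of_poly_zmod_morphism.

Fact fps_of_poly_monoid_morphism : monoid_morphism fps_of_poly.
Proof.
by split=> [|p q]; apply: fpsP => n; rewrite /= ?coefM // coef1.
Qed.
HB.instance Definition _ := GRing.isMonoidMorphism.Build {poly R} {fps R}
  fps_of_poly fps_of_poly_monoid_morphism.

Lemma fps_of_poly_inj : injective fps_of_poly.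
Proof.
by move=> p q [eq_pq]; apply/polyP => n; have /(congr1 (@^~ n)) := eq_pq.
Qed.

End FpsPoly.

Arguments fpsX R : clear implicits.

(* Q(z) is {fraction {poly rat}}, and Q((z)), the fraction field of Q[[z]], is
   {fraction {fps rat}}.  The embedding of the former into the latter sends
   p / q to p / q, both computed as power series. *)

Section Laurent.
Variable R : idomainType.
Local Notation emb p := (FracField.tofrac (fps_of_poly p) : {fraction {fps R}}).

Definition laurent_of_ratfun (x : {fraction {poly R}}) : {fraction {fps R}} :=
  emb \n_(repr x) / emb \d_(repr x).

Let emb_eq0 p : (emb p == 0) = (p == 0).
Proof.
by rewrite tofrac_eq0 -(inj_eq (@fps_of_poly_inj R)) rmorph0.
Qed.

Let emb_neq0 p : p != 0 -> emb p != 0.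
Proof. by rewrite emb_eq0. Qed.

Let ratfunE (x : {fraction {poly R}}) :
  x = FracField.tofrac \n_(repr x) / FracField.tofrac \d_(repr x).
Proof.
have d_neq0 := denom_ratioP (repr x); set n := \n__ in d_neq0 *.
set d := \d__ in d_neq0 *.
suff: x * FracField.tofrac d = FracField.tofrac n.
  by move<-; rewrite mulfK // tofrac_eq0.
rewrite -{1}[x]reprK; unlock FracField.tofrac.
rewrite -[LHS]FracField.pi_mul /FracField.mulf !numden_Ratio ?oner_neq0 //.
apply/eqmodP; rewrite /= FracField.equivfE !numden_Ratio ?mulf_neq0 ?oner_neq0 //.
by rewrite !mulr1 mulrC.
Qed.

Lemma laurent_of_ratfun_div (p q : {poly R}) : q != 0 ->
  laurent_of_ratfun (FracField.tofrac p / FracField.tofrac q) = emb p / emb q.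
Proof.
move=> q_neq0; rewrite /laurent_of_ratfun; set x := (X in repr X).
have d_neq0 := denom_ratioP (repr x); apply/eqP.
rewrite eqr_div ?emb_neq0 // -!rmorphM /= tofrac_eq.
rewrite (inj_eq (@fps_of_poly_inj R)) -tofrac_eq !rmorphM /=.
by rewrite -eqr_div ?tofrac_eq0 // -ratfunE.
Qed.

Fact laurent_of_ratfun_zmod_morphism : zmod_morphism laurent_of_ratfun.
Proof.
move=> x y; rewrite {1}[x]ratfunE {1}[y]ratfunE.
have dx := denom_ratioP (repr x); have dy := denom_ratioP (repr y).
rewrite -mulNr -rmorphN addf_div ?tofrac_eq0 // -!rmorphM -rmorphD /=.
rewrite laurent_of_ratfun_div ?mulf_neq0 // /laurent_of_ratfun.
by rewrite -mulNr addf_div ?emb_neq0 // !(rmorphD, rmorphM, rmorphN).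
Qed.
HB.instance Definition _ :=
  GRing.isZmodMorphism.Build {fraction {poly R}} {fraction {fps R}}
    laurent_of_ratfun laurent_of_ratfun_zmod_morphism.

Fact laurent_of_ratfun_monoid_morphism : monoid_morphism laurent_of_ratfun.
Proof.
split=> [|x y].
  have := @laurent_of_ratfun_div 1 1 (oner_neq0 _).
  by rewrite !rmorph1 !divr1.
rewrite {1}[x]ratfunE {1}[y]ratfunE mulf_div -!rmorphM /=.
rewrite laurent_of_ratfun_div ?mulf_neq0 ?denom_ratioP //.
by rewrite !rmorphM -mulf_div.
Qed.
HB.instance Definition _ :=
  GRing.isMonoidMorphism.Build {fraction {poly R}} {fraction {fps R}}
    laurent_of_ratfun laurent_of_ratfun_monoid_morphism.

End Laurent.

(* The polynomial in this definition is the minimal polynomial of u over F. *)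
Definition algebraic_of_degree (F K : fieldType) (iota : {rmorphism F -> K})
    (d : nat) (u : K) : Prop :=
  exists p : {poly F}, [/\ p \is monic, irreducible_poly p, size p = d.+1
    & root (map_poly iota p) u].

(* Main.v *)
(** Scan a word from left to right, recording the current minimum, the queue of
    letters seen once and the unused labels.  Nonnesting words treat the queue as
    first in, first out, and 123-avoidance forces the letters that are not weak
    left-to-right minima to be weakly decreasing.  Up to relabelling, the states
    from which the scan can be completed depend only on two integers, the number
    of unused labels above the minimum and the length of the queue, and their
    generating functions solve a linear system whose solution is explicit in terms
    of the series c = 1 + z c^2 and mu = 2 z (1 + mu + mu^2).  This gives
      C = 1 + 2 z (1 + 2 z) / (Y - 2 z (1 + 2 z)),  Y = (1 + 2 z) sigma + tau,
    where sigma^2 = 1 - 4 z and tau^2 = (1 - 6 z) (1 + 2 z).  The quartic equation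
    of C is the transform of the biquadratic equation of Y; C has degree 4 because
    1, sigma, tau and sigma tau are linearly independent over Q(z).  Finally two
    roots F and G of the quartic with the prescribed initial terms are equal
    because the divided difference of the quartic at F and G is nonzero. *)

Require Import Defs.
From mathcomp Require Import all_boot all_order all_algebra.
From mathcomp Require Import boolp ring lra zify.

Set Implicit Arguments.
Unset Strict Implicit.
Unset Printing Implicit Defensive.

Import Order.TTheory GRing.Theory Num.Theory.

(** * Scanning words *)

(** Patterns become forbidden subsequences, so that words can be treated by structural induction
    rather than by positions. *)
Definition nonnesting_seq (s : seq nat) :=
  forall a b, a != b -> ~~ subseq [:: a; b; b; a] s.

Definition avoids123_seq (s : seq nat) :=
  forall a b c, a < b < c -> ~~ subseq [:: a; b; c] s.

Lemma subseq_nthP (T : eqType) (x0 : T) (t s : seq T) :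
  reflect (exists2 js : seq nat, sorted ltn js & all (gtn (size s)) js
             && (t == [seq nth x0 s j | j <- js]))
    (subseq t s).
Proof.
apply: (iffP subseqP) => [[m sz_m ->]|[js js_sorted /andP[js_lt /eqP->]]].
  exists (mask m (iota 0 (size s))).
    by apply: (subseq_sorted ltn_trans (mask_subseq _ _)); apply: iota_ltn_sorted.
  rewrite map_mask -/(mkseq _ _) mkseq_nth eqxx andbT.
  by apply/allP => j /mem_mask; rewrite mem_iota.
have: subseq js (iota 0 (size s)).
  apply/subseqP; exists [seq j \in js | j <- iota 0 (size s)].
    by rewrite size_map.
  rewrite -filter_mask; apply: (irr_sorted_eq ltn_trans ltnn) => //.
    by apply: sorted_filter; [exact: ltn_trans | exact: iota_ltn_sorted].
  move=> j; rewrite mem_filter mem_iota /=; case: (boolP (j \in js)) => //.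
  by move/(allP js_lt).
case/subseqP => m sz_m js_m.
exists m; first by rewrite sz_m size_iota.
by rewrite js_m map_mask -/(mkseq _ _) mkseq_nth.
Qed.

Lemma nth_map_val m n (w : m.-tuple 'I_n) i (lt_im : i < m) :
  nth 0 [seq val x | x <- w] i = tnth w (Ordinal lt_im).
Proof.
by rewrite (tnth_nth (tnth w (Ordinal lt_im)))
  (nth_map (tnth w (Ordinal lt_im))) ?size_tuple.
Qed.

Lemma nth_map_ord m n (w : m.-tuple 'I_n) (i : 'I_m) :
  nth 0 [seq val x | x <- w] i = tnth w i.
Proof. by rewrite nth_map_val; congr (val (tnth w _)); apply: val_inj. Qed.

Lemma avoids123E n (w : n.*2.-tuple 'I_n) :
  avoids123 w <-> avoids123_seq [seq val x | x <- w].
Proof.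
split=> [w_av a b c /andP[ab bc]|w_av].
  apply: contra w_av => /(subseq_nthP 0)[js + /andP[+ /eqP js_w]].
  have := congr1 size js_w; case: js js_w => [|i [|j [|k []]]] //= js_w _.
  rewrite size_map size_tuple !andbT => /andP[ij jk] /and3P[lt_i lt_j lt_k].
  case: js_w => ai bj ck.
  apply/existsP; exists (Ordinal lt_i); apply/existsP; exists (Ordinal lt_j).
  apply/existsP; exists (Ordinal lt_k).
  move: ab bc; rewrite ai bj ck ij jk /= !nth_map_val.
  by move=> -> ->.
apply/existsP => -[i /existsP[j /existsP[k /and4P[ij jk ab bc]]]].
have /negP[] := w_av (tnth w i) (tnth w j) (tnth w k) (introT andP (conj ab bc)).
apply/(subseq_nthP 0); exists [:: val i; val j; val k].
  by rewrite /= ij jk.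
rewrite /= size_map size_tuple !ltn_ord /=.
by rewrite !nth_map_ord.
Qed.

Lemma nonnestingE n (w : n.*2.-tuple 'I_n) :
  nonnesting w <-> (forall a : 'I_n, count_mem (val a) [seq val x | x <- w] = 2)
               /\ nonnesting_seq [seq val x | x <- w].
Proof.
have count_val (a : 'I_n) : count_mem (val a) [seq val x | x <- w] = count_mem a w.
  by rewrite count_map; apply: eq_count => x /=; rewrite (inj_eq val_inj).
rewrite /nonnesting; split=> [/andP[/forallP w2 w_nn]|[w2 w_nn]].
  split=> [a|a b ab]; first by rewrite count_val; apply/eqP.
  apply: contra w_nn => /(subseq_nthP 0)[js + /andP[+ /eqP js_w]].
  have := congr1 size js_w; case: js js_w => [|i [|j [|k [|l []]]]] //= js_w _.
  rewrite size_map size_tuple !andbT => /and3P[ij jk kl].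
  case/and4P => lt_i lt_j lt_k lt_l; case: js_w => ai bj bk al.
  apply/existsP; exists (Ordinal lt_i); apply/existsP; exists (Ordinal lt_j).
  apply/existsP; exists (Ordinal lt_k); apply/existsP; exists (Ordinal lt_l).
  rewrite ij jk kl /=.
  move: ab ai bj bk al; rewrite !nth_map_val => ab ai bj bk al.
  by rewrite -!(inj_eq val_inj) /= -ai -al -bj -bk ab !eqxx.
apply/andP; split; first by apply/forallP => a; rewrite -count_val w2.
apply/existsP => -[i /existsP[j /existsP[k /existsP[l]]]].
case/and5P => ij jk kl /eqP il /andP[/eqP jk' ab].
have /negP[] := w_nn (tnth w i) (tnth w j) ab.
apply/(subseq_nthP 0); exists [:: val i; val j; val k; val l].
  by rewrite /= ij jk kl.
rewrite /= size_map size_tuple !ltn_ord /=.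
by rewrite !nth_map_ord -il -jk'.
Qed.

(** An occurrence of 123 that uses both [m] and [x] ends above [x]. Any other one uses at most one
    of them, as its smallest letter, which [minn m x] can replace. So a prefix matters only through
    its minimum. *)
Lemma avoids123_cons2 m x s :
  avoids123_seq (m :: x :: s) <->
  (x <= m) || all (geq x) s /\ avoids123_seq (minn m x :: s).
Proof.
split=> [s_av|[ok_x s_av] a b c /andP[ab bc]].
  split.
    have [//|lt_mx] := leqP x m; apply/allP => y ys /=; rewrite leqNgt.
    apply/negP => lt_xy; have /negP[] := s_av m x y (introT andP (conj lt_mx lt_xy)).
    by rewrite /= !eqxx sub1seq.
  move=> a b c abc; apply: contra (s_av a b c abc) => /subseq_trans; apply.
  rewrite /minn; case: ifP => _; first
    exact: (cat_subseq (subseq_refl [:: m]) (subseq_cons s x)).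
  exact: subseq_cons.
apply/negP => abc_sub.
have abc_s : subseq [:: a; b; c] s -> False.
  move=> abc_s; have /negP[] := s_av a b c (introT andP (conj ab bc)).
  exact: subseq_trans abc_s (subseq_cons _ _).
have bc_s : minn m x < b -> subseq [:: b; c] s -> False.
  move=> lt_b; move=> bc_s.
  have /negP[] := s_av (minn m x) b c (introT andP (conj lt_b bc)).
  by rewrite /= eqxx.
have le_s d : d \in s -> (x <= m) || (d <= x).
  move=> ds; have [//|lt_mx] := leqP x m.
  by move: ok_x; rewrite leqNgt lt_mx => /allP/(_ d ds) /= ->.
have b_s l : subseq (b :: l) s -> (x <= m) || (b <= x).
  by move/mem_subseq => bs; apply: le_s; apply: bs; rewrite mem_head.
move: abc_sub => /=. have [am|ne_am] := eqVneq a m.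
  have [bx|ne_bx] := eqVneq b x.
    by rewrite sub1seq => /le_s; lia.
  by move=> h; apply: bc_s h; lia.
have [ax|ne_ax] := eqVneq a x; last by [].
by move=> h; have bx := b_s _ h; apply: bc_s h; lia.
Qed.

Lemma subseq_cons_cat (T : eqType) (y : T) t p q :
  y \notin p -> subseq (y :: t) (p ++ y :: q) = subseq t q.
Proof.
elim: p => [|x p IHp] /=; first by rewrite eqxx.
by rewrite inE negb_or => /andP[/negPf-> /IHp].
Qed.

(** Only [Q] separates the two copies of [y] and it has no repeated letter, so [y] encloses no pair;
    being first, it is not enclosed either. *)
Lemma nonnesting_pop y Q s : uniq (y :: Q) -> y \notin s ->
  nonnesting_seq (y :: Q ++ y :: s) <-> nonnesting_seq (Q ++ s).
Proof.
rewrite cons_uniq => /andP[yQ uQ] ys; split=> nn a b ab; apply/negP => sub.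
  have /negP[] := nn a b ab; apply: subseq_trans sub _.
  apply: subseq_trans (subseq_cons _ y).
  by apply: cat_subseq => //; exact: subseq_cons.
have [ay|ne_ay] := eqVneq a y.
  (* Read from the right, the closing [y] of the pattern is matched with the second [y], since [s]
     has none; then [b] would occur twice in [Q]. *)
  have : subseq (rev [:: b; b; y]) (rev (Q ++ y :: s)).
    by rewrite subseq_rev; move: sub; rewrite /= ay eqxx.
  rewrite rev_cat (rev_cons y s) cat_rcons subseq_cons_cat ?mem_rev //.
  move=> /subseq_uniq; rewrite rev_uniq => /(_ uQ).
  by rewrite /= inE eqxx.
move: sub; rewrite /= (negPf ne_ay) => sub.
have [by_|ne_by] := eqVneq b y.
  have := leq_count_subseq (pred1 y) sub.
  rewrite by_ count_cat /= eqxx (negPf ne_ay) !(count_memPn _) //.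
have /negP[] := nn a b ab.
have : subseq [:: a; b; b; a] [seq x <- Q ++ y :: s | predC1 y x].
  by rewrite subseq_filter sub /= ne_ay ne_by.
move=> /subseq_trans; apply; rewrite filter_cat /= eqxx /=.
by apply: cat_subseq; exact: filter_subseq.
Qed.

(* Reading [s] after a prefix of minimum [m]: [Q] lists the letters seen once, in
   order of appearance, and [U] the letters not seen yet.  The next letter is
   either new or the head of [Q], by nonnesting; if it exceeds [m], no later
   letter can be larger, by 123-avoidance. *)
Fixpoint accepts m (Q U s : seq nat) {struct s} : bool :=
  if s is x :: s' then
    if x \in U then
      ((x <= m) || all (geq x) (rcons Q x ++ rem x U))
        && accepts (minn m x) (rcons Q x) (rem x U) s'
    else if Q is y :: Q' then
      [&& x == y, (x <= m) || all (geq x) (Q' ++ U)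
        & accepts (minn m x) Q' U s']
    else false
  else nilp Q && nilp U.

Lemma acceptsP m Q U s : uniq (Q ++ U) ->
  accepts m Q U s <->
  [/\ perm_eq s (Q ++ U ++ U), nonnesting_seq (Q ++ s) & avoids123_seq (m :: s)].
Proof.
(* The letters still to come are known from the state, so the bound on them can be tested in
   advance. *)
have all_dup x (A B s' : seq nat) : perm_eq s' (A ++ B ++ B) ->
    all (geq x) s' = all (geq x) (A ++ B).
  by move/perm_all->; rewrite !all_cat andbb.
elim: s m Q U => [|x s IHs] m Q U uQU.
  split=> /=; last by case=> /perm_size; rewrite !size_cat /nilp /= => szQU _ _; lia.
  case/andP=> /nilP-> /nilP->; split=> // a b c _ /=.
  by case: ifP.
rewrite (propext (avoids123_cons2 m x s)) /=; case: (boolP (x \in U)) => [xU|xNU].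
  have U_perm := perm_to_rem xU.
  have uQU' : uniq (rcons Q x ++ rem x U).
    rewrite cat_rcons (@perm_uniq _ _ (Q ++ U)) // perm_cat2l perm_sym //.
  have -> : perm_eq (x :: s) (Q ++ U ++ U) =
            perm_eq s (rcons Q x ++ rem x U ++ rem x U).
    rewrite -[RHS](perm_cons x).
    suff /permPr-> : perm_eq (Q ++ U ++ U)
        (x :: rcons Q x ++ rem x U ++ rem x U) by [].
    apply/permP => p; have /permP/(_ p) := U_perm.
    by rewrite -cats1 /= !count_cat /=; lia.
  rewrite -cat_rcons; split=> [/andP[ok_x]|].
    by case/(IHs _ _ _ uQU') => p nn av; split=> //; rewrite (all_dup _ _ _ _ p).
  case=> p nn []; rewrite (all_dup _ _ _ _ p) => -> av.
  by apply/(IHs _ _ _ uQU').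
case: Q uQU => [|y Q] uQU.
  split=> // -[/perm_mem/(_ x)]; rewrite !inE eqxx /= mem_cat.
  by rewrite (negPf xNU).
have uQ : uniq (y :: Q) by move: uQU; rewrite cat_uniq => /and3P[].
have uQU' : uniq (Q ++ U) by move: uQU => /= /andP[].
have yQU : y \notin Q ++ U ++ U.
  by move: uQU => /= /andP[]; rewrite !mem_cat orbb.
have [-> | ne_xy] /= := eqVneq x y; last first.
  (* If a queued [x] returns before the older [y], the word contains [y x x y]. *)
  split=> // -[p nn _].
  have xQ : x \in Q.
    have := perm_mem p x; rewrite !inE eqxx (negPf ne_xy) /= !mem_cat.
    by rewrite (negPf xNU) !orbF.
  have ys : y \in s.
    have := perm_mem p y; rewrite !inE eqxx /= eq_sym (negPf ne_xy) //=.
  have ne_yx : y != x by rewrite eq_sym.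
  have /negP[] := nn y x ne_yx; rewrite /= eqxx -[[:: x; x; y]]cat1s; apply: cat_subseq.
    by rewrite sub1seq.
  by rewrite /= eqxx sub1seq.
rewrite perm_cons; split=> [/andP[ok_y]|].
  case/(IHs _ _ _ uQU') => p nn av; split=> //.
    by apply/nonnesting_pop => //; rewrite (perm_mem p).
  by rewrite (all_dup _ _ _ _ p).
case=> p nn []; rewrite (all_dup _ _ _ _ p) => -> av.
apply/(IHs _ _ _ uQU'); split=> //.
by apply/(@nonnesting_pop y) => //; rewrite (perm_mem p).
Qed.

(** * Counting the accepted completions *)

Section Count.

Lemma sum_tuple_cons (T : finType) l (F : l.+1.-tuple T -> nat) :
  \sum_(w : l.+1.-tuple T) F w =
  \sum_(x : T) \sum_(w : l.-tuple T) F (cons_tuple x w).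
Proof.
rewrite pair_big (reindex (fun p : T * l.-tuple T => cons_tuple p.1 p.2)) //=.
exists (fun w => (thead w, behead_tuple w)) => [[x w] _ | w _] /=.
  by congr pair; apply: val_inj.
by apply: val_inj; case/tupleP: w.
Qed.

Lemma rem_cat_cons (T : eqType) (x : T) p q :
  x \notin p -> rem x (p ++ x :: q) = p ++ q.
Proof.
elim: p => [|y p IHp] /=; first by rewrite eqxx.
by rewrite inE negb_or eq_sym => /andP[/negPf-> /IHp->].
Qed.

Definition iota_down m := rev (iota 0 m).
Definition iota_gap x m := rev (iota x.+1 (m - x.+1)).

Lemma iota_downS m : iota_down m.+1 = m :: iota_down m.
Proof. by rewrite /iota_down -addn1 iotaD rev_cat. Qed.

Lemma mem_iota_down m x : (x \in iota_down m) = (x < m).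
Proof. by rewrite mem_rev mem_iota. Qed.

Lemma iota_down_split x m : x < m ->
  iota_down m = iota_gap x m ++ x :: iota_down x.
Proof.
move=> lt_xm; rewrite /iota_down /iota_gap.
have -> : m = x + (1 + (m - x.+1)) by lia.
by rewrite !iotaD !rev_cat add0n -catA /= addn1; congr (rev (iota _ _) ++ _); lia.
Qed.

Variable n : nat.

Definition count_suffixes l m Q U : nat :=
  \sum_(w : l.-tuple 'I_n) accepts m Q U [seq val x | x <- w].

Lemma count_suffixes0 m Q U : count_suffixes 0 m Q U = nilp Q && nilp U.
Proof.
by rewrite /count_suffixes (big_pred1 [tuple]) // => w; rewrite /= (tuple0 w).
Qed.

(* [q] leaves the queue before [Q2] and the second copy of any letter of [U], so
   once it lies above the minimum none of these may exceed it. *)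
Lemma accepts_dead m Q1 q Q2 U s :
  accepts m (Q1 ++ q :: Q2) U s -> m < q -> all (geq q) (Q2 ++ U).
Proof.
elim: s m Q1 Q2 U => [|x s IHs] m Q1 Q2 U /=; first by case: Q1.
move=> + lt_mq; case: (boolP (x \in U)) => [xU|xNU].
  case/andP=> _; rewrite rcons_cat rcons_cons => /IHs.
  have -> : minn m x < q by rewrite gtn_min lt_mq.
  move=> /(_ isT); rewrite !all_cat all_rcons (perm_all _ (perm_to_rem xU)) /=.
  by case/andP=> /andP[-> ->] ->.
case: Q1 => [|y Q1] /= /and3P[/eqP-> ok_x]; last first.
  by move/IHs; apply; rewrite gtn_min lt_mq.
by move: ok_x; rewrite leqNgt lt_mq.
Qed.

Lemma count_suffixes_dead l m Q1 q Q2 U : m < q -> ~~ all (geq q) (Q2 ++ U) ->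
  count_suffixes l m (Q1 ++ q :: Q2) U = 0.
Proof.
move=> lt_mq nle; rewrite /count_suffixes big1 // => w _.
by apply/eqP; rewrite eqb0; apply: contra nle => /accepts_dead; apply.
Qed.

Lemma count_suffixesS l m Q U : uniq (Q ++ U) -> all (gtn n) (Q ++ U) ->
  count_suffixes l.+1 m Q U =
  (if Q is y :: Q' then
     ((y <= m) || all (geq y) (Q' ++ U)) * count_suffixes l (minn m y) Q' U
   else 0)
  + \sum_(x <- U) ((x <= m) || all (geq x) (rcons Q x ++ rem x U))
      * count_suffixes l (minn m x) (rcons Q x) (rem x U).
Proof.
move=> uQU ltQU; rewrite /count_suffixes sum_tuple_cons /=.
pose push x := ((x <= m) || all (geq x) (rcons Q x ++ rem x U))
      * count_suffixes l (minn m x) (rcons Q x) (rem x U).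
pose pop x := if Q is y :: Q' then (x == y) *
     (((y <= m) || all (geq y) (Q' ++ U)) * count_suffixes l (minn m y) Q' U)
   else 0.
transitivity (\sum_(x < n) if val x \in U then push x else pop x).
  apply: eq_bigr => x _; rewrite /push /pop; case: ifP => _.
    by rewrite big_distrr; apply: eq_bigr => w _ /=; rewrite mulnb.
  case: (Q) => [|y Q']; first by rewrite big1.
  have [->|ne_xy] := eqVneq (val x) y; last by rewrite big1.
  by rewrite mul1n big_distrr; apply: eq_bigr => w _ /=; rewrite mulnb.
rewrite -(big_mkord xpredT (fun x => if x \in U then push x else pop x)).
rewrite (bigID (mem U)) /= addnC; congr (_ + _).
  case: Q uQU ltQU @push @pop => [|y Q] uQU ltQU push pop.
    by rewrite big1 // => x /negPf->.
  have yNU : y \notin U.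
    by move: uQU => /= /andP[]; rewrite mem_cat negb_or => /andP[].
  rewrite big_mkcond (bigD1_seq y) ?iota_uniq //=; last first.
    by rewrite mem_index_iota; move: ltQU => /= /andP[].
  rewrite (negPf yNU) /pop /= eqxx mul1n big1 ?addn0 // => x /negPf->.
  by rewrite mul0n; case: (x \in U).
rewrite -[RHS]/(\sum_(x <- U) push x) -big_filter (@perm_big _ _ _ _ _ U) => [|].
  by apply: eq_big_seq => x ->.
apply: uniq_perm; first by rewrite filter_uniq ?iota_uniq.
  by move: uQU; rewrite cat_uniq => /and3P[].
move=> x; rewrite mem_filter mem_index_iota /=; case: (boolP (x \in U)) => //= xU.
by move: ltQU; rewrite all_cat => /andP[_ /allP/(_ x xU)].
Qed.

Lemma count_suffixes_step l m Q V :
  sorted gtn (V ++ iota_down m.+1) -> uniq (Q ++ V ++ iota_down m) ->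
  all (gtn n) (Q ++ V ++ iota_down m) ->
  count_suffixes l.+1 m Q (V ++ iota_down m) =
  (if Q is y :: Q' then
     ((y <= m) || all (geq y) (Q' ++ V ++ iota_down m))
       * count_suffixes l (minn m y) Q' (V ++ iota_down m)
   else 0)
  + (if V is v :: V' then
       all (geq v) Q * count_suffixes l m (rcons Q v) (V' ++ iota_down m)
     else 0)
  + \sum_(0 <= x < m)
      count_suffixes l x (rcons Q x) ((V ++ iota_gap x m) ++ iota_down x).
Proof.
move=> sV uQV ltQV; rewrite count_suffixesS // -addnA; congr (_ + _).
have pV : pairwise gtn (V ++ iota_down m.+1).
  by rewrite -sorted_pairwise //; move=> x y w /= xy yw; apply: ltn_trans yw xy.
rewrite big_cat; congr (_ + _); last first.
  have down_perm : perm_eq (iota_down m) (iota 0 m) by rewrite perm_rev.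
  rewrite (perm_big _ down_perm) /=.
  rewrite /index_iota subn0; apply: eq_big_seq => x.
  rewrite mem_iota /= add0n => lt_xm.
  rewrite ltnW //= mul1n (minn_idPr (ltnW lt_xm)); congr count_suffixes.
  rewrite -/(iota_down m) (iota_down_split lt_xm) catA rem_cat_cons //.
  move: uQV; rewrite (iota_down_split lt_xm) [V ++ _]catA [Q ++ _]catA.
  rewrite cat_uniq => /and3P[_ /hasPn/(_ x (mem_head _ _)) /=].
  by rewrite mem_cat negb_or => /andP[].
case: V sV uQV ltQV pV => [|v V] sV uQV ltQV pV; first by rewrite big_nil.
move: pV; rewrite cat_cons pairwise_cons iota_downS all_cat /=.
case/andP=> /and3P[v_gtV lt_mv v_gtm] pV.
rewrite big_cons big1_seq ?addn0; last first.
  move=> x /andP[_ xV]; apply/eqP; rewrite muln_eq0 eqb0 negb_or.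
  have lt_xv : x < v by move/allP: v_gtV => /(_ x xV).
  move: pV; rewrite pairwise_cat.
  move=> /and3P[/allrelP/(_ x m xV (mem_head _ _)) /= lt_mx _ _].
  rewrite leqNgt lt_mx /= (gtn_eqF lt_xv) all_cat /= (leqNgt v x) lt_xv.
  by rewrite andbF.
rewrite leqNgt lt_mv /= eqxx (minn_idPl (ltnW lt_mv)); congr (nat_of_bool _ * _).
have le_v : all (geq v) (V ++ iota_down m).
  apply/allP => x; rewrite mem_cat => /orP[] xV; apply: ltnW.
    by move/allP: v_gtV => /(_ x xV).
  by move/allP: v_gtm => /(_ x xV).
by rewrite all_cat all_rcons le_v /= leqnn andbT.
Qed.

End Count.

Local Open Scope ring_scope.

(** * Generating functions of the states *)

Section FpsExtra.
Variable R : idomainType.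
Implicit Types f g h : {fps R}.
Local Notation z := (fpsX R).

Lemma coefs_fpsXM0 f : coefs (z * f) 0 = 0.
Proof. by rewrite coefsM big_ord_recl big_ord0 /= coefX mul0r addr0. Qed.

Lemma coefs_fpsXMS f n : coefs (z * f) n.+1 = coefs f n.
Proof.
rewrite coefsM 2!big_ord_recl big1 => [|i _] /=.
  by rewrite !coefX mul0r add0r mul1r addr0 subSS subn0.
by rewrite coefX mul0r.
Qed.

Definition eqfps n f g := forall i, (i < n)%N -> coefs f i = coefs g i.

Lemma eqfpsD n f g f' g' :
  eqfps n f g -> eqfps n f' g' -> eqfps n (f + f') (g + g').
Proof. by move=> fg fg' i lt_in; rewrite !coefsD fg ?fg'. Qed.

Lemma eqfpsM n f g f' g' :
  eqfps n f g -> eqfps n f' g' -> eqfps n (f * f') (g * g').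
Proof.
move=> fg fg' i lt_in; rewrite !coefsM; apply: eq_bigr => j _.
by rewrite fg ?fg' //; [rewrite (leq_ltn_trans _ lt_in) ?leq_subr
  | rewrite (leq_trans _ lt_in)].
Qed.

Lemma eqfps_fpsXM n f g : eqfps n f g -> eqfps n.+1 (z * f) (z * g).
Proof.
by move=> fg [|i] lt_in; rewrite ?coefs_fpsXM0 // !coefs_fpsXMS fg.
Qed.

(** The right-hand side is a [z]-adic contraction: each iteration settles one more coefficient, and
    the fixed point takes its coefficient of index [n] from the [n]-th iterate. *)
Lemma fps_quadratic_fixpoint p q r :
  exists y, y = p + z * (q * y + r * y ^+ 2).
Proof.
pose F y := p + z * (q * y + r * y ^+ 2).
have F_lip n f g : eqfps n f g -> eqfps n.+1 (F f) (F g).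
  move=> fg; apply: eqfpsD => //.
  apply: eqfps_fpsXM; apply: eqfpsD; apply: eqfpsM => //.
  by rewrite !expr2; apply: eqfpsM.
pose Y n := iter n F p.
have stepY n : eqfps n.+1 (Y n) (Y n.+1).
  elim: n => [|n IHn]; last exact: F_lip.
  by case=> // _; rewrite [RHS]coefsD coefs_fpsXM0 addr0.
have limY k n : eqfps n.+1 (Y n) (Y (k + n)%N).
  elim: k => [|k IHk] // i lt_in; rewrite IHk // stepY //.
  by rewrite (leq_trans lt_in) // ltnS leq_addl.
exists (Fps (fun n => coefs (Y n) n)); set y := Fps _.
have yY n : eqfps n.+1 y (Y n).
  move=> i lt_in; rewrite /= -(subnK (_ : i <= n)%N) //.
  exact: limY.
apply: fpsP => n; rewrite -/(F y).
by rewrite (F_lip _ _ _ (yY n)) // [LHS](stepY n).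
Qed.

End FpsExtra.

(* With [ring], proves an identity modulo [u = v], of cofactor [k]. *)
Lemma eq_lincomb (R : pzRingType) (k u v x y : R) :
  u = v -> x - y = k * (u - v) -> x = y.
Proof. by move=> -> /eqP; rewrite subrr mulr0 subr_eq0 => /eqP. Qed.

(** * Explicit solution of the linear system *)

Section Series.
Local Notation z := (fpsX rat).

(** Unfolding the recursion gives [G u = \sum_i z ^+ i.+1 * A (u + i)]; here [i = m - x.+1]. *)
Lemma coefs_series_sum (A G : nat -> {fps rat}) :
  (forall u, G u = z * A u + z * G u.+1) ->
  forall m u, \sum_(0 <= x < m) coefs (A (u + (m - x.+1))%N) x = coefs (G u) m.
Proof.
move=> GE; elim=> [|m IHm] u; rewrite GE coefsD.
  by rewrite big_geq // !coefs_fpsXM0 addr0.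
rewrite !coefs_fpsXMS big_nat_recr //= subnn addn0 addrC; congr (_ + _).
rewrite -IHm !big_nat; apply: eq_bigr => x /= lt_xm.
by congr (coefs (A _) _); lia.
Qed.

(** [c] is the Catalan series and [mu] is [t * M(t)] at [t = 2 * z], with [M] the Motzkin series;
    the last equation is [b = c ^+ 2 / (1 - (c ^+ 2 - 1) * mu)] without division. *)
Record kernel_series (c mu b : {fps rat}) := KernelSeries {
  kernel_cE : c = 1 + z * c ^+ 2;
  kernel_muE : mu = 2 * z * (1 + mu + mu ^+ 2);
  kernel_bE : b = c ^+ 2 + (c ^+ 2 - 1) * mu * b }.

Lemma kernel_series_exist : exists c mu b, kernel_series c mu b.
Proof.
have [c cE] := fps_quadratic_fixpoint (1 : {fps rat}) 0 1.
have [mu muE] := fps_quadratic_fixpoint (2 * z) (2 : {fps rat}) 2.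
(* Replacing the factor [mu] by its own equation exposes the [z] that the fixed point requires. *)
have [b bE] := fps_quadratic_fixpoint (c ^+ 2)
  ((c ^+ 2 - 1) * 2 * (1 + mu + mu ^+ 2)) 0.
exists c, mu, b; have muE' : mu = 2 * z * (1 + mu + mu ^+ 2).
  by rewrite {1}muE; ring.
split=> //; first by rewrite {1}cE; ring.
by rewrite {1}bE [in RHS]muE'; ring.
Qed.

Variables c mu b : {fps rat}.
Hypothesis cmb : kernel_series c mu b.

Let s := mu * b.
Let a := b + s.
Let lam := 1 + 2 * mu.
Definition gf_C := c + (c - 1) * (mu * b).
Let C := gf_C.

(* [gf_B0 u], [gf_B1 u] and [gf_A k u] are the generating functions of
   [free_count] (with empty or one-letter queue) and [min_queued_count] below,
   where [u] unused labels exceed the minimum.  They satisfy a linear recurrence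
   in [u], whose solutions over power series are geometric of ratio [lam], the
   small root of [z * lam ^+ 2 - lam + 1 + 3 * z = 0]. *)
Definition gf_B0 u := if u is u'.+1 then a * lam ^+ u' else C.
Definition gf_B1 u := b * lam ^+ u.
Definition gf_A k u :=
  if u is u'.+1 then (a + b) * lam ^+ u' else (C + s) * c ^+ k.+1 - s.
Definition gf_G k u :=
  if u is u'.+1 then s * lam ^+ u' else z * ((C + s) * c ^+ k.+1).

(* Recursive form of [gf_G k u = \sum_i z ^+ i.+1 * gf_A k (u + i)]: the next
   letter is a new minimum and skips [i] labels. *)
Lemma gf_GE k u : gf_G k u = z * gf_A k u + z * gf_G k u.+1.
Proof.
case: cmb => cE muE bE; case: u => [|u] /=; first by rewrite expr0; ring.
apply: (eq_lincomb (k := b * lam ^+ u) muE); rewrite exprS /a /s /lam; ring.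
Qed.

(** From here to [gf_B00E], each identity is a transition of the scan: the terms on the right are
    the viable next letters, a [gf_G] term gathers the new minima, and the [1] of [gf_B00E] is the
    end of the word. *)
Lemma gf_A0E u : gf_A 0 u.+1 = gf_B1 u + gf_B0 u.+1.
Proof. by rewrite /= /gf_B1; ring. Qed.

Lemma gf_A_0E k : gf_A k.+1 0 = gf_A k 0 + gf_G k.+2 0.
Proof.
case: cmb => cE _ _ /=; apply: (eq_lincomb (k := (C + s) * c ^+ k.+1) cE).
by rewrite !exprS /s; ring. Qed.

Lemma gf_A00E : gf_A 0 0 = gf_B0 0 + gf_G 1 0.
Proof. case: cmb => cE _ _ /=; apply: (eq_lincomb (k := C + s) cE).
by rewrite /s; ring. Qed.

Lemma gf_B1E u : gf_B1 u = gf_B0 u + gf_G 1 u.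
Proof.
case: cmb => cE muE bE; case: u => [|u] /=; last first.
  by rewrite /gf_B1 exprS /a /s /lam; ring.
rewrite /gf_B1 /= /C /s /gf_C /lam expr0.
apply: (eq_lincomb (k := 1) bE).
by apply: (eq_lincomb (k := c * (1 + mu * b)) cE); ring.
Qed.

Lemma gf_B0E u : gf_B0 u.+1 = gf_B1 u + gf_G 0 u.+1.
Proof. by rewrite /= /gf_B1 /a; ring. Qed.

Lemma gf_B00E : gf_B0 0 = 1 + gf_G 0 0.
Proof.
case: cmb => cE muE bE; rewrite /= /C /s /gf_C.
apply: (eq_lincomb (k := 1 + mu * b) cE); ring.
Qed.

End Series.

(** * State counts as coefficients of the series *)

Section StateCounts.
Local Open Scope nat_scope.
Local Arguments coefs : simpl never.
Local Arguments gf_B0 : simpl never.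
Local Arguments gf_A : simpl never.
Local Arguments gf_G : simpl never.
Local Notation z := (fpsX rat).
Variables c mu b : {fps rat}.
Hypothesis cmb : kernel_series c mu b.
Variable n : nat.
Local Notation count := (count_suffixes n).
Local Notation gf_B0 := (gf_B0 c mu b).
Local Notation gf_B1 := (gf_B1 mu b).
Local Notation gf_A := (gf_A c mu b).
Local Notation gf_G := (gf_G c mu b).

(* The states in which the scan can still succeed, [V] being the unused labels
   above the minimum [m]: [m] has left the queue ([free_count]), [m] is the last
   letter of the queue ([min_queued_count]), or one larger letter [x] follows [m]
   in the queue ([overtaken_count]). *)
Definition gf_B k u := if k is 0 then gf_B0 u else gf_B1 u.

Definition free_count l := forall m Q V, size Q <= 1 ->
  sorted gtn (Q ++ V ++ iota_down m.+1) -> all (gtn n) (Q ++ V ++ iota_down m) ->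
  l = size (Q ++ (V ++ iota_down m) ++ (V ++ iota_down m)) ->
  (count l m Q (V ++ iota_down m))%:R%R = coefs (gf_B (size Q) (size V)) m.

Definition min_queued_count l := forall m Q V,
  sorted gtn (Q ++ V ++ iota_down m.+1) -> all (gtn n) (Q ++ V ++ iota_down m.+1) ->
  l = size (rcons Q m ++ (V ++ iota_down m) ++ (V ++ iota_down m)) ->
  (count l m (rcons Q m) (V ++ iota_down m))%:R%R
    = coefs (gf_A (size Q) (size V)) m.

Definition overtaken_count l := forall m x V,
  sorted gtn (x :: V ++ iota_down m.+1) -> all (gtn n) (x :: V ++ iota_down m.+1) ->
  l = size ([:: m; x] ++ (V ++ iota_down m) ++ (V ++ iota_down m)) ->
  (count l m [:: m; x] (V ++ iota_down m))%:R%R = coefs (gf_B1 (size V)) m.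

Lemma gtn_trans : transitive gtn.
Proof. by move=> y x w /= xy yw; apply: ltn_trans yw xy. Qed.

Lemma sorted_gtn_uniq s : sorted gtn s -> uniq s.
Proof. by apply: sorted_uniq; [exact: gtn_trans | exact: ltnn]. Qed.

Lemma sorted_gtn_cons x s : sorted gtn (x :: s) -> all (gtn x) s.
Proof. exact: order_path_min gtn_trans. Qed.

Lemma all_gtn_geq x s : all (gtn x) s -> all (geq x) s.
Proof. by move/allP=> lt_x; apply/allP => y /lt_x /= /ltnW. Qed.

Lemma size_iota_gap x m : size (iota_gap x m) = m - x.+1.
Proof. by rewrite size_rev size_iota. Qed.

Lemma size_iota_down m : size (iota_down m) = m.
Proof. by rewrite size_rev size_iota. Qed.

(** A new minimum [x] enters the queue last and leaves [m - x.+1] more labels above the minimum,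
    hence the sum of [coefs_series_sum]. *)
Lemma sum_new_min l m Q V : min_queued_count l ->
  sorted gtn (Q ++ V ++ iota_down m) -> all (gtn n) (Q ++ V ++ iota_down m) ->
  l.+1 = size (Q ++ (V ++ iota_down m) ++ (V ++ iota_down m)) ->
  (\sum_(0 <= x < m)
    count l x (rcons Q x) ((V ++ iota_gap x m) ++ iota_down x))%:R%R
  = coefs (gf_G (size Q) (size V)) m.
Proof.
move=> IH sQV ltQV sz_l; rewrite natr_sum -(coefs_series_sum (gf_GE cmb (size Q))).
rewrite !big_nat; apply: eq_bigr => x /= lt_xm.
have E : iota_gap x m ++ iota_down x.+1 = iota_down m.
  by rewrite iota_downS -iota_down_split.
rewrite IH ?size_cat ?size_iota_gap // -?catA ?E //.
move: sz_l; rewrite !size_cat size_rcons !size_iota_down.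
by lia.
Qed.

Lemma sum_dead l m Q1 q Q2 V : m <= q -> ~~ all (geq q) (Q2 ++ V) ->
  \sum_(0 <= x < m)
    count l x (rcons (Q1 ++ q :: Q2) x) ((V ++ iota_gap x m) ++ iota_down x) = 0.
Proof.
move=> le_mq nle; rewrite big_nat big1 // => x /= lt_xm.
rewrite rcons_cat rcons_cons count_suffixes_dead ?(leq_trans lt_xm) //.
apply: contra nle; rewrite -cats1 !all_cat.
by move=> /andP[/andP[-> _] /andP[/andP[-> _] _]].
Qed.

Lemma free_countS l : free_count l -> min_queued_count l -> free_count l.+1.
Proof.
move=> IHB IHA m Q V szQ sQV ltQV sz_l.
have sQV' : sorted gtn (Q ++ V ++ iota_down m).
  apply: (subseq_sorted gtn_trans _ sQV).
  by rewrite iota_downS !cat_subseq ?subseq_cons.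
have sV : sorted gtn (V ++ iota_down m.+1).
  by apply: (subseq_sorted gtn_trans _ sQV); exact: suffix_subseq.
rewrite (count_suffixes_step _ sV (sorted_gtn_uniq sQV')) // !natrD.
rewrite (sum_new_min IHA) //.
case: Q szQ sQV ltQV sz_l sQV' => [_|q [_|//]] sQV ltQV sz_l sQV'.
  case: V sV sQV ltQV sz_l sQV' => [|v V] sV sQV ltQV sz_l sQV' /=.
    rewrite (gf_B00E cmb) coefsD coefs1 !add0r; case: m {sV sQV ltQV sQV'} sz_l => //.
    by move=> m _; rewrite add0r.
  rewrite (gf_B0E c mu b) coefsD add0r mul1n; congr +%R.
  by apply: (IHB m [:: v] V) => //; move: sz_l; rewrite /= !size_cat /= !size_cat; lia.
have /sorted_gtn_cons lt_q := sQV.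
rewrite -[gf_B _ _]/(gf_B1 (size V)) (gf_B1E cmb) coefsD; congr +%R.
have lt_mq : m < q.
  by move/allP: lt_q => /(_ m); apply; rewrite iota_downS mem_cat mem_head orbT.
rewrite [X in (X + _)%R](_ : _ = coefs (gf_B0 (size V)) m); last first.
  have /sorted_gtn_cons/all_gtn_geq -> := sQV'.
  rewrite orbT mul1n (minn_idPl (ltnW lt_mq)).
  apply: (IHB m [::] V) => //; first by case/andP: ltQV.
  by move: sz_l; rewrite /= => -[].
(* While [q] is queued, [v] cannot be read: the larger [q] would follow it. *)
case: V lt_q {sV sQV ltQV sz_l sQV'} => [|v V]; first by rewrite addr0.
by move=> /= /andP[lt_vq _]; rewrite leqNgt lt_vq mul0n addr0.
Qed.

(** With [V] empty, the next letter is the head of the queue or a new minimum. Otherwise a new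
    minimum is fatal, since [m] would lie above it with larger letters still to come, and [v] can be
    read only if [Q] is empty. *)
Lemma min_queued_countS l : free_count l -> min_queued_count l ->
  overtaken_count l -> min_queued_count l.+1.
Proof.
move=> IHB IHA IHO m Q V sQV ltQV sz_l.
have sV : sorted gtn (V ++ iota_down m.+1).
  by apply: (subseq_sorted gtn_trans _ sQV); exact: suffix_subseq.
have Q_perm : perm_eq (rcons Q m ++ V ++ iota_down m) (Q ++ V ++ iota_down m.+1).
  by rewrite cat_rcons perm_cat2l iota_downS -cat1s perm_catCA.
have uQV : uniq (rcons Q m ++ V ++ iota_down m).
  by rewrite (perm_uniq Q_perm) sorted_gtn_uniq.
have ltQV' : all (gtn n) (rcons Q m ++ V ++ iota_down m).
  by rewrite (perm_all _ Q_perm).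
rewrite (count_suffixes_step _ sV uQV) // !natrD.
case: Q sQV ltQV sz_l {Q_perm uQV} ltQV' => [|q Q] sQV ltQV sz_l ltQV' /=.
  rewrite leqnn minnn mul1n (IHB m [::] V) //; last 2 first.
    by move: ltQV' => /= /andP[].
    by move: sz_l => /= [].
  case: V sV sQV ltQV sz_l ltQV' => [|v V] sV sQV ltQV sz_l ltQV' /=.
    rewrite (gf_A00E cmb) coefsD addr0; congr +%R.
    apply: (@sum_new_min l m [:: m] [::]) => //.
      by move: sV; rewrite iota_downS.
  have /sorted_gtn_cons lt_v := sV.
  have lt_mv : m < v.
    by move/allP: lt_v => /(_ m); apply; rewrite iota_downS mem_cat mem_head orbT.
  rewrite (@sum_dead _ _ [::] m [::] (v :: V)) //=; last by rewrite leqNgt lt_mv.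
  rewrite (ltnW lt_mv) mul1n addr0 (gf_A0E c mu b) coefsD addrC; congr +%R.
  apply: IHO => //.
  by move: sz_l; rewrite /= !size_cat /= !size_cat /=; lia.
have /sorted_gtn_cons lt_q := sQV.
have lt_mq : m < q.
  by move/allP: lt_q => /(_ m); apply; rewrite iota_downS !mem_cat mem_head !orbT.
have le_q : all (geq q) (rcons Q m ++ V ++ iota_down m).
  move/all_gtn_geq: lt_q; rewrite iota_downS !all_cat all_rcons /=.
  by case/and4P => -> -> -> ->.
rewrite le_q orbT mul1n (minn_idPl (ltnW lt_mq)) IHA //; last 3 first.
- by apply: (subseq_sorted gtn_trans _ sQV); exact: subseq_cons.
- by move: ltQV => /= /andP[].
- by move: sz_l => /= [].
case: V sV sQV ltQV sz_l ltQV' lt_q {le_q} => [|v V] sV sQV ltQV sz_l ltQV' lt_q /=.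
  rewrite (gf_A_0E cmb) coefsD addr0; congr +%R.
  have -> : (size Q).+2 = size (rcons (q :: Q) m) by rewrite size_rcons.
  by apply: (@sum_new_min l m (rcons (q :: Q) m) [::]) => //=;
    rewrite cat_rcons -iota_downS.
have lt_vq : v < q.
  by move/allP: lt_q => /(_ v); apply; rewrite mem_cat mem_head orbT.
have lt_mv : m < v.
  have /sorted_gtn_cons/allP/(_ m) := sV; apply.
  by rewrite iota_downS mem_cat mem_head orbT.
rewrite [q <= v]leqNgt lt_vq mul0n addr0.
have := @sum_dead l m (q :: Q) m [::] (v :: V) (leqnn m).
by rewrite /= [v <= m]leqNgt lt_mv cats1 => -> //; rewrite addr0.
Qed.

Lemma overtaken_countS l : free_count l -> overtaken_count l.+1.
Proof.
move=> IHB m x V sV ltV sz_l.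
have sV' : sorted gtn (V ++ iota_down m.+1).
  by apply: (subseq_sorted gtn_trans _ sV); exact: subseq_cons.
have V_perm : perm_eq ([:: m; x] ++ V ++ iota_down m) (x :: V ++ iota_down m.+1).
  apply/permP => p; rewrite iota_downS /= !count_cat /=; lia.
have uV : uniq ([:: m; x] ++ V ++ iota_down m).
  by rewrite (perm_uniq V_perm) sorted_gtn_uniq.
have ltV' : all (gtn n) ([:: m; x] ++ V ++ iota_down m).
  by rewrite (perm_all _ V_perm).
have /sorted_gtn_cons lt_x := sV.
have lt_mx : m < x.
  by move/allP: lt_x => /(_ m); apply; rewrite iota_downS mem_cat mem_head orbT.
rewrite (count_suffixes_step _ sV' uV) // (@sum_dead _ _ [::] m [:: x]) //=; last first.
  by rewrite leqNgt lt_mx.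
rewrite leqnn minnn mul1n addn0 natrD (IHB m [:: x] V) //; last 2 first.
  by move: ltV' => /= /andP[].
  by move: sz_l => /= [].
case: V lt_x {sV ltV sz_l sV' V_perm uV ltV'} => [|v V]; first by rewrite addr0.
by move=> /= /andP[lt_vx _]; rewrite [x <= v]leqNgt lt_vx andbF mul0n addr0.
Qed.

Lemma count_suffixesE l :
  [/\ free_count l, min_queued_count l & overtaken_count l].
Proof.
elim: l => [|l [IHB IHA IHO]].
  split=> [m [|//] [|//] _ _ _|m [|//]|//] //.
  rewrite /= size_cat size_iota_down; case: m => // _.
  rewrite count_suffixes0 /= (gf_B00E cmb) coefsD coefs1.
  by rewrite /gf_G coefs_fpsXM0 addr0.
split; [exact: free_countS | exact: min_queued_countS | exact: overtaken_countS].
Qed.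

End StateCounts.

Lemma nonnesting123_countE c mu b n : kernel_series c mu b ->
  (nonnesting123_count n)%:R = coefs (gf_C c mu b) n.
Proof.
move=> cmb; have [B_n _ _] := count_suffixesE cmb n n.*2.
have := B_n n [::] [::] isT; rewrite /= => <-; last 3 first.
- rewrite -[sorted _ _]rev_sorted.
  by rewrite revK; apply: iota_ltn_sorted.
- by apply/allP => x; rewrite mem_iota_down.
- by rewrite size_cat size_iota_down addnn.
congr _%:R; rewrite /count_suffixes /nonnesting123_count.
rewrite -sum1_card big_mkcond /=; apply: eq_bigr => w _; rewrite inE.
have uI : uniq ([::] ++ iota_down n) by rewrite rev_uniq iota_uniq.
suff -> : nonnesting w && avoids123 w =
   accepts n [::] (iota_down n) [seq val x | x <- w] by case: accepts.
apply/idP/idP.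
  case/andP=> /nonnestingE[w2 w_nn] /avoids123E w_av.
  apply/(acceptsP _ _ uI); split=> //.
    apply/allP => x _ /=; rewrite count_cat.
    have [lt_xn|le_nx] := ltnP x n.
      by rewrite (w2 (Ordinal lt_xn)) count_uniq_mem ?mem_iota_down ?lt_xn.
    rewrite !(count_memPn _) ?mem_iota_down -?leqNgt //.
    by apply/negP => /mapP[y _ xy]; move: le_nx; rewrite xy leqNgt ltn_ord.
  move=> a d e ade; apply/negP => /=; case: eqVneq => [an|_]; last first.
    exact/negP/w_av.
  move=> /mem_subseq/(_ d (mem_head _ _))/mapP[y _ dy].
  by move: ade; rewrite an dy ltnNge ltnW.
case/(acceptsP _ _ uI) => w_perm w_nn w_av; apply/andP; split.
  apply/nonnestingE; split=> // a.
  rewrite (permP w_perm) cat0s count_cat count_uniq_mem ?rev_uniq ?iota_uniq //.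
  by rewrite mem_iota_down ltn_ord.
apply/avoids123E => a d e ade; apply: contra (w_av a d e ade).
by move/subseq_trans; apply; exact: subseq_cons.
Qed.

(** * Algebraicity *)

Section LowCoefs.
Variable R : idomainType.
Implicit Types f g : {fps R}.

Lemma coefsM0 f g : coefs (f * g) 0 = coefs f 0 * coefs g 0.
Proof. by rewrite coefsM big_ord1. Qed.

Lemma coefsM1 f g :
  coefs (f * g) 1 = coefs f 0 * coefs g 1 + coefs f 1 * coefs g 0.
Proof. by rewrite coefsM big_ord_recl big_ord1. Qed.

Lemma coefs_nat0 k : coefs (k%:R : {fps R}) 0 = k%:R.
Proof. by elim: k => // k IHk; rewrite !mulrSr coefsD IHk coefs1. Qed.

Lemma coefs_nat1 k : coefs (k%:R : {fps R}) 1 = 0.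
Proof. by elim: k => // k IHk; rewrite mulrSr coefsD IHk coefs1 addr0. Qed.

Lemma coefs_fpsX0 : coefs (fpsX R) 0 = 0. Proof. exact: coefX. Qed.
Lemma coefs_fpsX1 : coefs (fpsX R) 1 = 1. Proof. exact: coefX. Qed.

Definition low_coefsE := (coefsD, coefsN, coefsM0, coefsM1, coefs_nat0,
  coefs_nat1, coefs_fpsX0, coefs_fpsX1, coefs1).

End LowCoefs.

Section Low.
Variable R : idomainType.
Implicit Types f g : {fps R}.

(** Arithmetic modulo [z ^+ 2]: [f] is congruent to [x + y * z]. *)
Definition low f x y := coefs f 0 = x /\ coefs f 1 = y.

Lemma low_eq f x y x' y' : low f x y -> x = x' -> y = y' -> low f x' y'.
Proof. by move=> fxy <- <-. Qed.

Lemma low_nat k : low (k%:R : {fps R}) k%:R 0.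
Proof. by split; [exact: coefs_nat0 | exact: coefs_nat1]. Qed.

Lemma lowN f x y : low f x y -> low (- f) (- x) (- y).
Proof. by case=> <- <-. Qed.

Lemma lowD f g x y x' y' :
  low f x y -> low g x' y' -> low (f + g) (x + x') (y + y').
Proof. by case=> <- <- [<- <-]. Qed.

Lemma lowM f g x y x' y' :
  low f x y -> low g x' y' -> low (f * g) (x * x') (x * y' + y * x').
Proof. by case=> <- <- [<- <-]; split; [exact: coefsM0 | exact: coefsM1]. Qed.

End Low.

(** * Linear independence and the quartic equation *)

Section Algebraic.
Local Notation z := (fpsX rat).
Local Notation "a %:S" := (fps_of_poly a) (at level 1, format "a %:S").

Lemma poly_rat_eq0 (p : {poly rat}) (x : nat -> rat) :
  injective x -> (forall k, p.[x k] = 0) -> p = 0.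
Proof.
move=> x_inj px0; apply/eqP; apply: contraT => p_neq0.
have := @max_poly_roots _ p (mkseq x (size p)) p_neq0.
rewrite size_mkseq ltnn => -> //; last by rewrite mkseq_uniq.
by apply/allP => y /mapP[k _ ->]; apply/rootP.
Qed.

Lemma horner_nat (k : nat) (x : rat) : (k%:R : {poly rat}).[x] = k%:R.
Proof. by rewrite -polyC_natr hornerC. Qed.

Definition horner_ratE := (hornerD, hornerN, hornerM, horner_exp, hornerX,
  horner_nat, fun x : rat => hornerC 1 x : (1 : {poly rat}).[x] = 1).

Lemma poly_1DX_neq0 (p : {poly rat}) : 1 + 'X * p != 0.
Proof.
apply/eqP => /(congr1 (fun q : {poly rat} => q`_0)) /eqP.
by rewrite coefD coef1 coefXM coef0 addr0 oner_eq0.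
Qed.

Lemma poly_rat_nat_neq0 k : (k.+1%:R : {poly rat}) != 0.
Proof. by rewrite -polyC_natr polyC_eq0 pnatr_eq0. Qed.

Variables c mu b : {fps rat}.
Hypothesis cmb : kernel_series c mu b.
Local Notation C := (gf_C c mu b).
(** [sigma] and [tau] are square roots of the discriminants of the quadratic equations of [c] and
    [mu]. *)
Local Notation sigma := (1 - 2 * z * c).
Local Notation tau := (1 - 2 * z - 4 * z * mu).
Local Notation h := (2 * z * (1 + 2 * z)).
Local Notation W := ((1 + 2 * z) * sigma + tau - h).

Lemma sigma_sqr : sigma ^+ 2 = 1 - 4 * z.
Proof.
by case: cmb => cE _ _; apply: (eq_lincomb (k := - (4 * z)) cE); ring.
Qed.

Lemma tau_sqr : tau ^+ 2 = (1 - 6 * z) * (1 + 2 * z).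
Proof.
by case: cmb => _ muE _; apply: (eq_lincomb (k := - (8 * z)) muE); ring.
Qed.

Lemma coefs_c0 : coefs c 0 = 1.
Proof. by rewrite (kernel_cE cmb) !low_coefsE mul0r addr0. Qed.

Lemma coefs_c1 : coefs c 1 = 1.
Proof.
rewrite (kernel_cE cmb) coefsD coefs1 coefs_fpsXMS expr2 coefsM0 coefs_c0.
by rewrite add0r mul1r.
Qed.

Lemma coefs_mu0 : coefs mu 0 = 0.
Proof. by rewrite (kernel_muE cmb) !low_coefsE mulr0 mul0r. Qed.

Lemma coefs_C0 : coefs C 0 = 1.
Proof. by rewrite /gf_C !low_coefsE coefs_c0 subrr mul0r addr0. Qed.

Lemma coefs_C1 : coefs C 1 = 1.
Proof.
by rewrite /gf_C !low_coefsE coefs_c0 coefs_c1 coefs_mu0 /=; ring.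
Qed.

(** This Möbius relation between [C] and [Y = W + h] carries both the equation and the independence
    from [Y] to [C]. *)
Lemma gf_C_moebius : (C - 1) * W = h.
Proof.
have [cE muE bE] := cmb.
(* This is the denominator of [b]; multiplying by it allows [b] to be eliminated. *)
have D_neq0 : 1 - (c ^+ 2 - 1) * mu != 0.
  apply/eqP => /(congr1 (fun f => coefs f 0)).
  by rewrite !low_coefsE coefs_mu0 mulr0 subr0 => /eqP; rewrite oner_eq0.
apply: (mulfI D_neq0).
apply: (eq_lincomb (k := (c - 1) * mu * W) bE).
apply: (eq_lincomb (k := 2 * (c - 1)) muE).
by apply: (eq_lincomb (k := 2 * (1 + 2 * z)) cE); rewrite /gf_C; ring.
Qed.

(* At [x > 1/4], [sigma ^+ 2] is negative. *)
Lemma indep_sigma (u v : {poly rat}) : u%:S + v%:S * sigma = 0 -> u = 0 /\ v = 0.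
Proof.
move=> uv0.
have uv_sqr : u ^+ 2 = v ^+ 2 * (1 - 4 * 'X).
  apply: (@fps_of_poly_inj rat).
  rewrite !(rmorphM, rmorphXn, rmorphB, rmorph1, rmorph_nat) /=.
  rewrite -[_ 'X]/z -sigma_sqr.
  by apply: (eq_lincomb (k := u%:S - v%:S * sigma) uv0); ring.
have uv_root k : u.[k.+1%:R] = 0 /\ v.[k.+1%:R] = 0.
  have := congr1 (horner^~ k.+1%:R) uv_sqr; rewrite !horner_ratE.
  have : (1 : rat) <= k.+1%:R by rewrite ler1n.
  move: (k.+1%:R) => x x_ge1 e.
  have u2 := sqr_ge0 u.[x]; have v2 := sqr_ge0 v.[x].
  have v2x : 0 <= v.[x] ^+ 2 * (x - 1) by rewrite mulr_ge0 // subr_ge0.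
  by split; apply/eqP; rewrite -sqrf_eq0; apply/eqP; lra.
have x_inj : injective (fun k => k.+1%:R : rat).
  by move=> i j /eqP; rewrite eqr_nat => /eqP[].
by split; apply: (poly_rat_eq0 x_inj) => k; case: (uv_root k).
Qed.

(* At [x < - 1/2], [sigma ^+ 2] is positive and [tau ^+ 2] negative. *)
Lemma indep_sigma_tau (u0 u1 u2 u3 : {poly rat}) :
  u0%:S + u1%:S * sigma + (u2%:S + u3%:S * sigma) * tau = 0 ->
  [/\ u0 = 0, u1 = 0, u2 = 0 & u3 = 0].
Proof.
move=> u_0.
pose delta : {poly rat} := (1 - 6 * 'X) * (1 + 2 * 'X).
(* Multiplying the relation by its conjugate under [tau -> - tau] leaves an element of Q(z)(sigma);
   its [sigma]-free part is the combination of squares evaluated below. *)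
have [] := @indep_sigma
  (u0 ^+ 2 + u1 ^+ 2 * (1 - 4 * 'X) - delta * (u2 ^+ 2 + u3 ^+ 2 * (1 - 4 * 'X)))
  (2 * (u0 * u1 - delta * (u2 * u3))).
  rewrite /delta !(rmorphM, rmorphXn, rmorphB, rmorphD, rmorph1, rmorph_nat) /=.
  rewrite -[_ 'X]/z -tau_sqr -sigma_sqr.
  apply: (eq_lincomb (k := u0%:S + u1%:S * sigma - (u2%:S + u3%:S * sigma) * tau) u_0).
  by ring.
move=> norm0 _.
have u_root k (x := - k.+1%:R : rat) :
  [/\ u0.[x] = 0, u1.[x] = 0, u2.[x] = 0 & u3.[x] = 0].
  have := congr1 (horner^~ x) norm0; rewrite /delta !horner_ratE horner0.
  have : x <= -1 by rewrite lerN2 ler1n.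
  move: x => x x_le e.
  have d_lt : (1 - 6 * x) * (1 + 2 * x) < 0 by nra.
  have e_gt : 0 < 1 - 4 * x by lra.
  move: e_gt d_lt e; move: (1 - 4 * x) ((1 - 6 * x) * (1 + 2 * x)).
  move=> ep de ep_gt de_lt e.
  have sq0 y := sqr_ge0 (y : rat).
  have ep1 := mulr_ge0 (sq0 u1.[x]) (ltW ep_gt).
  have ep3 := mulr_ge0 (sq0 u3.[x]) (ltW ep_gt).
  have s2 : 0 <= - de * (u2.[x] ^+ 2) by rewrite mulr_ge0 // oppr_ge0 ltW.
  have s3 : 0 <= - de * (u3.[x] ^+ 2 * ep) by rewrite mulr_ge0 // oppr_ge0 ltW.
  have eq0 y : y ^+ 2 = 0 :> rat -> y = 0 by move=> /eqP; rewrite sqrf_eq0 => /eqP.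
  have s0 := sq0 u0.[x].
  have mul0 t y : t != 0 -> t * y = 0 :> rat -> y = 0.
    by move=> /negPf t0 /eqP; rewrite mulf_eq0 t0 => /eqP.
  split; apply: eq0; first by lra.
  - by apply: (@mul0 ep); [rewrite gt_eqF | rewrite mulrC; lra].
  - by apply: (@mul0 (- de)); [rewrite oppr_eq0 lt_eqF | lra].
  - apply: (@mul0 ep); first by rewrite gt_eqF.
    by apply: (@mul0 (- de)); [rewrite oppr_eq0 lt_eqF | rewrite [ep * _]mulrC; lra].
have x_inj : injective (fun k => - k.+1%:R : rat).
  by move=> i j /oppr_inj /eqP; rewrite eqr_nat => /eqP[].
by split; apply: (poly_rat_eq0 x_inj) => k; case: (u_root k).
Qed.

Lemma fps_nat_neq0 k : (k.+1%:R : {fps rat}) != 0.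
Proof.
apply/eqP => /(congr1 (fun f => coefs f 0)).
by rewrite coefs_nat0 coefs0 => /eqP; rewrite pnatr_eq0.
Qed.

Lemma fpsX_neq0 : z != 0.
Proof.
by apply/eqP => /(congr1 (fun f => coefs f 1)); rewrite coefs_fpsX1.
Qed.

Lemma fps_of_poly_eq0 (p : {poly rat}) : (p%:S == 0) = (p == 0).
Proof. by rewrite -(inj_eq (@fps_of_poly_inj rat)) rmorph0. Qed.

Lemma moebius_const_neq0 : h != 0.
Proof.
rewrite !mulf_neq0 ?fps_nat_neq0 ?fpsX_neq0 //.
apply/eqP => /(congr1 (fun f => coefs f 0)).
by rewrite !low_coefsE mulr0 addr0 => /eqP; rewrite oner_eq0.
Qed.

Lemma gf_C_cubic_indep (a0 a1 a2 a3 : {poly rat}) :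
  a0%:S + a1%:S * C + a2%:S * C ^+ 2 + a3%:S * C ^+ 3 = 0 ->
  [/\ a0 = 0, a1 = 0, a2 = 0 & a3 = 0].
Proof.
move=> a_C.
(* Multiplied by [W ^+ 3], the relation becomes a cubic in
   [Y = (1 + 2 * z) * sigma + tau] with coefficients [k0], ..., [k3]. *)
pose H : {poly rat} := 2 * 'X * (1 + 2 * 'X).
pose E : {poly rat} := (1 + 2 * 'X) ^+ 2 * (1 - 4 * 'X).
pose Dl : {poly rat} := (1 - 6 * 'X) * (1 + 2 * 'X).
pose k0 := - H ^+ 3 * a0.
pose k1 := H ^+ 2 * (3 * a0 + a1).
pose k2 := - H * (3 * a0 + 2 * a1 + a2).
pose k3 := a0 + a1 + a2 + a3.
have CW : C * W = W + h by apply: (eq_lincomb (k := 1) gf_C_moebius); ring.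
have cubic : a0%:S * W ^+ 3 + a1%:S * (W + h) * W ^+ 2
     + a2%:S * (W + h) ^+ 2 * W + a3%:S * (W + h) ^+ 3 = 0.
  by rewrite -!CW; apply: (eq_lincomb (k := W ^+ 3) a_C); ring.
(* These are the components of the cubic along [1], [sigma], [tau] and [sigma * tau], where [E] and
   [Dl] stand for the squares of [(1 + 2 * z) * sigma] and [tau]. *)
have [] := @indep_sigma_tau (k0 + k2 * (E + Dl))
  ((1 + 2 * 'X) * (k1 + k3 * (E + 3 * Dl)))
  (k1 + k3 * (3 * E + Dl)) (2 * (1 + 2 * 'X) * k2).
  rewrite /k0 /k1 /k2 /k3 /E /Dl /H.
  rewrite !(rmorphM, rmorphXn, rmorphB, rmorphD, rmorphN, rmorph1, rmorph_nat) /=.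
  rewrite -[_ 'X]/z -[RHS]cubic -sigma_sqr -tau_sqr.
  by move: sigma tau => s t; ring.
have g_neq0 : 1 + 2 * 'X != 0 :> {poly rat} by rewrite mulrC poly_1DX_neq0.
have H_neq0 : H != 0 by rewrite !mulf_neq0 ?polyX_eq0 ?poly_rat_nat_neq0.
have EDl_neq0 : E - Dl != 0.
  have -> : E - Dl = 4 * 'X * (1 + 2 * 'X) * (1 + 'X * (- 2)).
    by rewrite /E /Dl; ring.
  by rewrite !mulf_neq0 ?polyX_eq0 ?poly_rat_nat_neq0 ?poly_1DX_neq0.
have cancel (k a : {poly rat}) : k != 0 -> k * a = 0 -> a = 0.
  by move=> /negPf kN0 /eqP; rewrite mulf_eq0 kN0 => /eqP.
move=> e0 e1 e2 e3.
have k2_0 : k2 = 0 by apply: cancel e3; rewrite !mulf_neq0 ?poly_rat_nat_neq0.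
have {}e1 := cancel _ _ g_neq0 e1.
(* The difference of [e2] and [e1] is [2 * (E - Dl) * k3 = 0]. *)
have k3_0 : k3 = 0.
  apply: (cancel (2 * (E - Dl))); first by rewrite !mulf_neq0 ?poly_rat_nat_neq0.
  by apply: (eq_lincomb (k := 1) e2); apply: (eq_lincomb (k := -1) e1); ring.
have k1_0 : k1 = 0 by move: e1; rewrite k3_0 mul0r addr0.
have k0_0 : k0 = 0 by move: e0; rewrite k2_0 mul0r addr0.
have a0_0 : a0 = 0 by apply: cancel k0_0; rewrite oppr_eq0 expf_neq0.
have a1_0 : a1 = 0.
  have := cancel _ _ (expf_neq0 2 H_neq0) k1_0.
  by rewrite a0_0 mulr0 add0r.
have a2_0 : a2 = 0.
  have : - H != 0 by rewrite oppr_eq0.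
  by move=> /cancel/(_ k2_0); rewrite a0_0 a1_0 !mulr0 !add0r.
by split=> //; move: k3_0; rewrite /k3 a0_0 a1_0 a2_0 !add0r.
Qed.

Lemma gf_C_quartic :
  (1 - 4 * z + 4 * z ^+ 2)
  + (- 4 + 16 * z - 16 * z ^+ 2) * C
  + (5 - 22 * z + 36 * z ^+ 2 + 8 * z ^+ 3) * C ^+ 2
  + (- 2 + 12 * z - 40 * z ^+ 2 - 16 * z ^+ 3) * C ^+ 3
  + (- 2 * z + 17 * z ^+ 2 + 12 * z ^+ 3 + 4 * z ^+ 4) * C ^+ 4 = 0.
Proof.
(* The equation derived from [Y] is [4 * h ^+ 2] times the quartic. *)
have h2_neq0 : 4 * h ^+ 2 != 0.
  by rewrite mulf_neq0 ?fps_nat_neq0 ?expf_neq0 ?moebius_const_neq0.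
apply: (mulfI h2_neq0); rewrite mulr0.
have CY : (C - 1) * ((1 + 2 * z) * sigma + tau) = h * C.
  by apply: (eq_lincomb (k := 1) gf_C_moebius); ring.
(* Squaring isolates and removes the mixed term [2 * (1 + 2 * z) * sigma * tau]; [CY] then replaces
   [Y] by [h * C / (C - 1)], denominators cleared by [(C - 1) ^+ 4]. *)
have biquad : (((1 + 2 * z) * sigma + tau) ^+ 2
   - (1 + 2 * z) ^+ 2 * sigma ^+ 2 - tau ^+ 2) ^+ 2
   = 4 * (1 + 2 * z) ^+ 2 * sigma ^+ 2 * tau ^+ 2 by ring.
move: CY biquad; rewrite sigma_sqr tau_sqr; move: (_ * sigma + tau) => Y CY biquad.
have quartic : ((h * C) ^+ 2 - (C - 1) ^+ 2 *
    ((1 + 2 * z) ^+ 2 * (1 - 4 * z) + (1 - 6 * z) * (1 + 2 * z))) ^+ 2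
    = 4 * (1 + 2 * z) ^+ 2 * (1 - 4 * z) * ((1 - 6 * z) * (1 + 2 * z)) * (C - 1) ^+ 4.
  by rewrite -CY; apply: (eq_lincomb (k := (C - 1) ^+ 4) biquad); ring.
by apply: (eq_lincomb (k := 1) quartic); ring.
Qed.

End Algebraic.

(** * Degree exactly four *)

Section Degree.
Local Notation K := {fraction {poly rat}}.
Local Notation E := {fraction {fps rat}}.
Local Notation iota := (@laurent_of_ratfun rat).
Local Notation emb f := (FracField.tofrac f : E).
Local Notation "a %:S" := (fps_of_poly a) (at level 1, format "a %:S").

Lemma emb_poly_neq0 (d : {poly rat}) : d != 0 -> emb d%:S != 0.
Proof. by rewrite tofrac_eq0 fps_of_poly_eq0. Qed.

Lemma laurent_of_tofrac (a : {poly rat}) : iota (FracField.tofrac a) = emb a%:S.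
Proof.
have := laurent_of_ratfun_div a (oner_neq0 {poly rat}).
by rewrite !rmorph1 !divr1.
Qed.

Lemma common_denominator m (x : 'I_m -> K) :
  exists2 d : {poly rat}, d != 0 &
    exists a : 'I_m -> {poly rat}, forall i, iota (x i) * emb d%:S = emb (a i)%:S.
Proof.
pose num i := \n_(repr (x i)); pose den i := \d_(repr (x i)).
have den_neq0 i : den i != 0 by apply: denom_ratioP.
exists (\prod_i den i); first by apply/prodf_neq0 => i _.
exists (fun i => num i * \prod_(j | j != i) den j) => i.
rewrite (bigD1 i) //= !rmorphM /= mulrA /laurent_of_ratfun -/(num i) -/(den i).
by rewrite divfK ?emb_poly_neq0.
Qed.

Variables c mu b : {fps rat}.
Hypothesis cmb : kernel_series c mu b.
Local Notation C := (gf_C c mu b).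

(** Clearing denominators gives a relation of degree at most 3 over Q[z], which [gf_C_cubic_indep]
    forces to be trivial. *)
Lemma root_C_size_gt4 (p : {poly K}) :
  p != 0 -> root (map_poly iota p) (emb C) -> (4 < size p)%N.
Proof.
move=> p_neq0 /rootP pC; rewrite ltnNge; apply: contra p_neq0 => sz_p.
have [d d_neq0 [a aE]] := common_denominator (fun i : 'I_4 => p`_i).
have sumC0 : \sum_(i < 4) (a (inord i))%:S * C ^+ i = 0.
  have : \sum_(i < 4) iota p`_i * emb C ^+ i = 0.
    rewrite -[RHS]pC (@horner_coef_wide _ 4) ?size_map_poly //.
    by apply: eq_bigr => i _; rewrite coef_map.
  move/(congr1 ( *%R (emb d%:S))); rewrite mulr0 big_distrr /= => sum0.
  apply/eqP; rewrite -tofrac_eq0 rmorph_sum -[X in _ == X]sum0 /=.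
  apply/eqP; apply: eq_bigr => i _.
  by rewrite rmorphM rmorphXn inord_val /= -aE mulrA [iota _ * _]mulrC.
have [] := @gf_C_cubic_indep _ _ _ cmb
  (a (inord 0)) (a (inord 1)) (a (inord 2)) (a (inord 3)).
  by rewrite -sumC0 !big_ord_recr big_ord0 /= expr0 mulr1 add0r.
move=> a0 a1 a2 a3.
have a_0 i : a i = 0.
  by rewrite -(inord_val i); case: i => -[|[|[|[|]]]].
apply/eqP/polyP => i; rewrite coef0; have [lt_i4|le_4i] := ltnP i 4.
  have /eqP := aE (Ordinal lt_i4); rewrite a_0 !rmorph0 mulf_eq0 /=.
  by rewrite (negPf (emb_poly_neq0 d_neq0)) orbF fmorph_eq0 => /eqP.
by rewrite nth_default // (leq_trans sz_p).
Qed.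

Definition quartic_coefs : seq {poly rat} :=
  [:: 1 - 4 * 'X + 4 * 'X ^+ 2; - 4 + 16 * 'X - 16 * 'X ^+ 2;
      5 - 22 * 'X + 36 * 'X ^+ 2 + 8 * 'X ^+ 3;
      - 2 + 12 * 'X - 40 * 'X ^+ 2 - 16 * 'X ^+ 3;
      - 2 * 'X + 17 * 'X ^+ 2 + 12 * 'X ^+ 3 + 4 * 'X ^+ 4].

Definition quartic_minpoly : {poly K} :=
  \poly_(i < 5)
    (FracField.tofrac quartic_coefs`_i / FracField.tofrac quartic_coefs`_4).

Lemma quartic_lead_neq0 : quartic_coefs`_4 != 0.
Proof.
apply/eqP => /(congr1 (horner^~ 1)); rewrite /= !horner_ratE horner0 => e; lra.
Qed.

Lemma tofrac_lead_neq0 : FracField.tofrac quartic_coefs`_4 != 0.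
Proof. by rewrite tofrac_eq0 quartic_lead_neq0. Qed.

Lemma size_quartic_minpoly : size quartic_minpoly = 5.
Proof. by rewrite size_poly_eq //= divff ?oner_neq0 // tofrac_lead_neq0. Qed.

Lemma quartic_minpoly_monic : quartic_minpoly \is monic.
Proof. by rewrite monicE lead_coef_poly //= divff ?oner_neq0 ?tofrac_lead_neq0. Qed.

Lemma root_quartic_minpoly : root (map_poly iota quartic_minpoly) (emb C).
Proof.
apply/rootP; rewrite horner_coef size_map_poly size_quartic_minpoly.
have lead_neq0 := emb_poly_neq0 quartic_lead_neq0.
apply: (mulfI lead_neq0); rewrite mulr0 big_distrr /=.
transitivity (\sum_(i < 5) emb ((quartic_coefs`_i)%:S * C ^+ i)).
  apply: eq_bigr => i _.
  have -> : (map_poly iota quartic_minpoly)`_i =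
      emb (quartic_coefs`_i)%:S / emb (quartic_coefs`_4)%:S.
    rewrite coef_map coef_poly ltn_ord -!laurent_of_tofrac.
    exact: fmorph_div.
  by rewrite mulrA mulrCA divff // mulr1 [in RHS]rmorphM rmorphXn.
rewrite -rmorph_sum; apply/eqP; rewrite tofrac_eq0; apply/eqP.
rewrite -[RHS](gf_C_quartic cmb) !big_ord_recl big_ord0 /=.
rewrite !(rmorphM, rmorphXn, rmorphB, rmorphD, rmorphN, rmorph1, rmorph_nat) /=.
by rewrite /bump /= -[_ 'X]/(fpsX rat); ring.
Qed.

(** In any factorization of the quartic, the factor vanishing at [C] has degree at least 4, so the
    other one is constant. *)
Lemma gf_C_degree4 : algebraic_of_degree iota 4 (emb C).
Proof.
exists quartic_minpoly; split; [exact: quartic_minpoly_monic | |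
  exact: size_quartic_minpoly | exact: root_quartic_minpoly].
have p_neq0 : quartic_minpoly != 0 by rewrite monic_neq0 ?quartic_minpoly_monic.
split; first by rewrite size_quartic_minpoly.
move=> q sz_q /dvdpP[r pE].
have := p_neq0; rewrite pE mulf_eq0 negb_or => /andP[r_neq0 q_neq0].
have sz_r0 : (0 < size r)%N by rewrite size_poly_gt0.
have sz_q0 : (0 < size q)%N by rewrite size_poly_gt0.
have sz_rq : (size r + size q)%N.-1 = 5%N.
  by rewrite -(size_mul r_neq0 q_neq0) -pE size_quartic_minpoly.
have := root_quartic_minpoly; rewrite pE rmorphM rootM => /orP[rC|qC].
  have sz_r : (4 < size r)%N := root_C_size_gt4 r_neq0 rC.
  have : size q = 1%N by lia.
  by move=> sz_q1; rewrite sz_q1 in sz_q.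
have sz_q4 : (4 < size q)%N := root_C_size_gt4 q_neq0 qC.
have sz_q5 : size q = 5%N by lia.
rewrite -pE -dvdp_size_eqp ?size_quartic_minpoly ?sz_q5 //.
by rewrite pE dvdp_mulIr.
Qed.

End Degree.

(** * Uniqueness of the solution *)

Lemma quartic_unique (F G : {fps rat}) (z := fpsX rat)
  (P := fun F : {fps rat} => (1 - 4 * z + 4 * z ^+ 2)
        + (- 4 + 16 * z - 16 * z ^+ 2) * F
        + (5 - 22 * z + 36 * z ^+ 2 + 8 * z ^+ 3) * F ^+ 2
        + (- 2 + 12 * z - 40 * z ^+ 2 - 16 * z ^+ 3) * F ^+ 3
        + (- 2 * z + 17 * z ^+ 2 + 12 * z ^+ 3 + 4 * z ^+ 4) * F ^+ 4) :
  coefs F 0 = 1 -> coefs F 1 = 1 -> P F = 0 ->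
  coefs G 0 = 1 -> coefs G 1 = 1 -> P G = 0 -> F = G.
Proof.
move=> F0 F1 PF G0 G1 PG.
(* [Q] is the divided difference of the quartic at [F] and [G]. *)
pose Q := (- 4 + 16 * z - 16 * z ^+ 2)
        + (5 - 22 * z + 36 * z ^+ 2 + 8 * z ^+ 3) * (F + G)
        + (- 2 + 12 * z - 40 * z ^+ 2 - 16 * z ^+ 3) * (F * F + F * G + G * G)
        + (- 2 * z + 17 * z ^+ 2 + 12 * z ^+ 3 + 4 * z ^+ 4)
            * ((F + G) * (F * F + G * G)).
have : (F - G) * Q = 0.
  apply: (eq_lincomb (k := 1) PF); apply: (eq_lincomb (k := -1) PG).
  by rewrite /P /Q; ring.
move/eqP; rewrite mulf_eq0 => /orP[|/eqP Q0]; first by rewrite subr_eq0 => /eqP.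
have lF : low F 1 1 by [].
have lG : low G 1 1 by [].
have lz : low z 0 1 by split; [exact: coefs_fpsX0 | exact: coefs_fpsX1].
have lzn k : low (z ^+ k.+2) 0 0.
  elim: k => [|k IHk]; last by rewrite exprS; apply: low_eq (lowM lz IHk) _ _; ring.
  by rewrite expr2; apply: low_eq (lowM lz lz) _ _; ring.
pose n := @low_nat rat.
have l1 := lowD (lowD (lowN (n 4)) (lowM (n 16) lz)) (lowN (lowM (n 16) (lzn 0))).
have l2 := lowD (lowD (lowD (n 5) (lowN (lowM (n 22) lz))) (lowM (n 36) (lzn 0)))
  (lowM (n 8) (lzn 1)).
have l3 := lowD (lowD (lowD (lowN (n 2)) (lowM (n 12) lz))
  (lowN (lowM (n 40) (lzn 0)))) (lowN (lowM (n 16) (lzn 1))).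
have l4 := lowD (lowD (lowD (lowM (lowN (n 2)) lz) (lowM (n 17) (lzn 0)))
  (lowM (n 12) (lzn 1))) (lowM (n 4) (lzn 2)).
have lFF := lowM lF lF; have lFG := lowM lF lG; have lGG := lowM lG lG.
(* The constant term of [Q] is 0, so the contradiction comes from its coefficient of [z], which is
   -2 by the prescribed initial terms. *)
have [_] : low Q _ _ :=
  lowD (lowD (lowD l1 (lowM l2 (lowD lF lG))) (lowM l3 (lowD (lowD lFF lFG) lGG)))
    (lowM l4 (lowM (lowD lF lG) (lowD lFF lGG))).
rewrite Q0 coefs0 {l1 l2 l3 l4 lFF lFG lGG lF lG lz lzn n Q Q0 PF PG F0 G0 F1 G1} => e.
by exfalso; lra.
Qed.

Theorem corollary1p2 :
  let z : {fps rat} := fpsX rat in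
  let C : {fps rat} := Fps (fun n => (nonnesting123_count n)%:R) in
  algebraic_of_degree (@laurent_of_ratfun rat) 4 (FracField.tofrac C) /\
  unique (fun F : {fps rat} =>
    [/\ coefs F 0%N = 1, coefs F 1%N = 1 &
        (1 - 4 * z + 4 * z ^+ 2)
        + (- 4 + 16 * z - 16 * z ^+ 2) * F
        + (5 - 22 * z + 36 * z ^+ 2 + 8 * z ^+ 3) * F ^+ 2
        + (- 2 + 12 * z - 40 * z ^+ 2 - 16 * z ^+ 3) * F ^+ 3
        + (- 2 * z + 17 * z ^+ 2 + 12 * z ^+ 3 + 4 * z ^+ 4) * F ^+ 4 = 0]) C.
Proof.
move=> z C.
have [c [mu [b cmb]]] := kernel_series_exist.
have -> : C = gf_C c mu b.
  by apply: fpsP => n; rewrite -(nonnesting123_countE n cmb).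
split; first exact: gf_C_degree4.
split=> [|F [F0 F1 PF]].
  split; [exact: coefs_C0 cmb | exact: coefs_C1 cmb | exact: gf_C_quartic].
by apply: quartic_unique F0 F1 PF; [exact: coefs_C0 cmb | exact: coefs_C1 cmb
  | exact: gf_C_quartic].
Qed.
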